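(* Define polynomials $\gamma_n(x,y)$ by $\gamma_1(x,y)=xy$ and $\gamma_{n+1}(x,y)=(4n+2)xy\gamma_n(x,y)+xy(1-2x)\frac{\partial}{\partial x}\gamma_n(x,y)+xy(1-4y)\frac{\partial}{\partial y}\gamma_n(x,y)$, and write $\gamma_n(x,y)=\sum_{i,j}\gamma_{n,i,j}x^iy^j$. Then for $n\ge1$, $$\gamma_{n,i,j}=\#\{\sigma\in\mathcal Q_n:\ \mathrm{des}(\sigma)=i,\ \mathrm{laplat}(\sigma)=j,\ \mathrm{desp}(\sigma)=0\}.$$
   Context: $\mathcal Q_n$ is the set of Stirling permutations of order $n$: permutations $\sigma=\sigma_1\cdots\sigma_{2n}$ of $\{1,1,2,2,\dots,n,n\}$ such that for each $i$, all entries between the two occurrences of $i$ are larger than $i$. Set $\sigma_0=\sigma_{2n+1}=0$. $\mathrm{des}(\sigma)=\#\{i:0\le i\le 2n,\ \sigma_i>\sigma_{i+1}\}$. An index $i\in[2n-1]$ is a left ascent-plateau if $\sigma_{i-1}<\sigma_i=\sigma_{i+1}$ and a descent-plateau if $\sigma_{i-1}>\sigma_i=\sigma_{i+1}$; $\mathrm{laplat}(\sigma)$ and $\mathrm{desp}(\sigma)$ count them. *)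

(* Defs.v *)
(* MathComp, with the multinomials library. *)
From mathcomp Require Export all_boot all_order all_algebra.
From mathcomp.multinomials Require Export mpoly.

Set Implicit Arguments.
Unset Strict Implicit.
Unset Printing Implicit Defensive.

Import GRing.Theory.

(* The multiset {1,1,2,2,...,n,n}. *)
Definition double_iota (n : nat) : seq nat :=
  flatten [seq [:: k; k] | k <- iota 1 n].

(* In a rearrangement s of {1,1,...,n,n}, positions a < c with equal entries
   are the two occurrences of that entry. *)
Definition stirling (s : seq nat) : bool :=
  [forall a : 'I_(size s), forall b : 'I_(size s), forall c : 'I_(size s),
    [&& a < b, b < c & nth 0 s a == nth 0 s c] ==> (nth 0 s a < nth 0 s b)].

(* [permutations] lists each rearrangement exactly once, so counting in this
   list is counting Stirling permutations. *)
Definition stirling_perms (n : nat) : seq (seq nat) :=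
  [seq s <- permutations (double_iota n) | stirling s].

(* sigma_k, indexed from 1, with sigma_0 = sigma_(2n+1) = 0. *)
Definition entry (s : seq nat) (k : nat) : nat := nth 0 (0 :: rcons s 0) k.

Definition des (s : seq nat) : nat :=
  count (fun i => entry s i > entry s i.+1) (iota 0 (size s).+1).

(* For both plateau statistics, i ranges over 1, ..., size s - 1. *)
Definition laplat (s : seq nat) : nat :=
  count (fun i => (entry s i.-1 < entry s i) && (entry s i == entry s i.+1))
        (iota 1 (size s).-1).

Definition desp (s : seq nat) : nat :=
  count (fun i => (entry s i.-1 > entry s i) && (entry s i == entry s i.+1))
        (iota 1 (size s).-1).

Local Open Scope ring_scope.

Definition vx : 'I_2 := ord0.
Definition vy : 'I_2 := ord_max.

Definition X : {mpoly int[2]} := 'X_vx.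
Definition Y : {mpoly int[2]} := 'X_vy.

(* [gamma 0] is a dummy value; the recursion starts at [gamma 1]. *)
Fixpoint gamma (n : nat) : {mpoly int[2]} :=
  match n with
  | 0 => 0
  | 1 => X * Y
  | m.+1 => (4 * m + 2)%:R * X * Y * gamma m
            + X * Y * (1 - 2%:R * X) * (gamma m)^`M(vx)
            + X * Y * (1 - 4%:R * Y) * (gamma m)^`M(vy)
  end.

Lemma gammaS (n : nat) : (0 < n)%N ->
  gamma n.+1 = (4 * n + 2)%:R * X * Y * gamma n
               + X * Y * (1 - 2%:R * X) * (gamma n)^`M(vx)
               + X * Y * (1 - 4%:R * Y) * (gamma n)^`M(vy).
Proof. by case: n. Qed.

Definition monXY (i j : nat) : 'X_{1..2} := (U_(vx) *+ i + U_(vy) *+ j)%MM.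

(* Main.v *)
Require Import Defs.
From mathcomp Require Import zify ring.

(* A Stirling permutation of order n+1 arises from exactly one of order n by
   inserting the adjacent pair (n+1)(n+1) in one of the 2n+1 gaps.  The effect
   on (des, laplat, desp) depends only on the gap: a descent, one of the two
   gaps of a left ascent-plateau (its ascent and its plateau), the plateau of a
   descent-plateau, or one of the remaining gaps.  This gives a recursion for
   the number N n i j k of Stirling permutations with des = i, laplat = j,
   desp = k.  That recursion does not close on k = 0, but it is solved by
     N n i j k = gamma_(n,i,j) * 'C(2n + 1 - i - 2j, k),
   where 2n + 1 - i - 2j is the number of ascents that do not start a left
   ascent-plateau when desp = 0.  The theorem is the case k = 0. *)

Set Implicit Arguments.
Unset Strict Implicit.
Unset Printing Implicit Defensive.

(** * Stirling permutations built by inserting the largest pair *)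

Lemma subseq_cons_nthP (T : eqType) (x0 x : T) (t s : seq T) :
  subseq (x :: t) s <->
  exists a, [/\ a < size s, nth x0 s a = x & subseq t (drop a.+1 s)].
Proof.
split; last first.
  case=> a [a_lt <- sub_t]; rewrite -{2}(cat_take_drop a s) (drop_nth x0 a_lt).
  apply: subseq_trans (suffix_subseq _ _).
  by rewrite -cat1s -(cat1s _ (drop _ _)) subseq_cat2l.
elim: s => [|y s IHs] //=; case: eqP => [-> sub_t|_ /IHs [a [? ? ?]]].
  by exists 0; rewrite drop0.
by exists a.+1.
Qed.

(** Pattern avoidance passes to subsequences, so letters can be deleted or inserted without tracking
    indices. *)
Lemma stirlingP (s : seq nat) :
  reflect (forall x y : nat, subseq [:: x; y; x] s -> x < y) (stirling s).
Proof.
apply: (iffP idP) => [stir x y|stir].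
  case/(subseq_cons_nthP 0) => a [a_lt xE].
  case/(subseq_cons_nthP 0) => b; rewrite size_drop nth_drop => -[b_lt yE].
  case/(subseq_cons_nthP 0) => c.
  rewrite drop_drop size_drop nth_drop => -[c_lt xE' _].
  have b_lt' : a.+1 + b < size s by rewrite -ltn_subRL.
  have c_lt' : b.+1 + a.+1 + c < size s by rewrite -ltn_subRL.
  move/forallP/(_ (Ordinal a_lt))/forallP/(_ (Ordinal b_lt')): stir.
  move=> /forallP/(_ (Ordinal c_lt'))/implyP /=.
  rewrite xE xE' yE eqxx andbT; apply; lia.
apply/forallP => a; apply/forallP => b; apply/forallP => c.
apply/implyP => /and3P [ab bc /eqP ac]; apply: stir.
apply/(subseq_cons_nthP 0); exists a; split=> //.
apply/(subseq_cons_nthP 0); exists (b - a.+1).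
rewrite size_drop nth_drop subnKC //; split=> //.
  by rewrite ltn_sub2r // (leq_ltn_trans ab).
rewrite drop_drop addSn subnK //; apply/(subseq_cons_nthP 0); exists (c - b.+1).
rewrite size_drop nth_drop ac; split; last exact: sub0seq.
  by rewrite ltn_sub2r // (leq_ltn_trans bc).
by congr nth; lia.
Qed.

Definition insert2 (N : nat) (s : seq nat) (g : nat) : seq nat :=
  take g s ++ [:: N, N & drop g s].

(** No forbidden pattern uses [N]: as inner letter it exceeds the outer ones, and as outer letter it
    would need something between its two adjacent copies. *)
Lemma stirling_insert2 (N : nat) (p q : seq nat) : all (ltn^~ N) (p ++ q) ->
  stirling (p ++ [:: N, N & q]) = stirling (p ++ q).
Proof.
move=> lt_N; have ltP x : x \in p ++ q -> x < N by move/(allP lt_N).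
apply/stirlingP/stirlingP => stir x y sub_xyx.
  apply: stir; apply: subseq_trans sub_xyx _; rewrite subseq_cat2l.
  exact: (suffix_subseq [:: N; N]).
have [xN|xN] := eqVneq x N; last first.
  have x_pq : x \in p ++ q.
    have : x \in p ++ [:: N, N & q].
      by apply: (mem_subseq sub_xyx); rewrite mem_head.
    by rewrite !mem_cat !inE (negPf xN).
  have [->|yN] := eqVneq y N; first exact: ltP.
  (* Deleting every [N] keeps the pattern, neither of whose letters is [N]. *)
  apply: stir; have -> : p ++ q = [seq z <- p ++ [:: N, N & q] | z != N].
    rewrite filter_cat /= eqxx /= -filter_cat; apply/esym/all_filterP.
    by apply: sub_all lt_N => z /= z_lt; rewrite ltn_eqF.
  by rewrite subseq_filter /= xN yN.
subst x; have pN : N \notin p.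
  by apply/negP => Np; have := ltP N; rewrite mem_cat Np ltnn => /(_ isT).
have qN : N \notin q.
  by apply/negP => Nq; have := ltP N; rewrite mem_cat Nq orbT ltnn => /(_ isT).
have yN : y != N.
  have filterN r : N \notin r -> [seq z <- r | z == N] = [::].
    by move=> Nr; apply/eqP/negPn; rewrite -has_filter (has_pred1 N).
  apply/eqP => yN; move: (sub_xyx); rewrite yN => sub_N.
  have : subseq [:: N; N; N] [seq z <- p ++ [:: N, N & q] | z == N].
    by rewrite subseq_filter /= eqxx.
  rewrite filter_cat /= !eqxx !filterN //=; by rewrite !eqxx.
(* As [p] has no [N], the pattern starts at the inserted pair; its inner letter differs from [N],
   which forces its last [N] into [q]. *)
move: sub_xyx; elim: p {stir lt_N ltP} pN => [|z p IHp] /=; last first.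
  by rewrite inE negb_or => /andP[/negPf -> /IHp].
rewrite eqxx (negPf yN) => _ /mem_subseq/(_ N).
by rewrite !inE eqxx orbT (negPf qN) => /(_ isT).
Qed.

Lemma double_iotaS (n : nat) :
  double_iota n.+1 = double_iota n ++ [:: n.+1; n.+1].
Proof. by rewrite /double_iota -{1}(addn1 n) iotaD map_cat flatten_cat. Qed.

Lemma double_iota_bound (n x : nat) : x \in double_iota n -> 0 < x <= n.
Proof.
elim: n => [|n IHn]; first by rewrite in_nil.
rewrite double_iotaS mem_cat !inE => /orP[/IHn|]; lia.
Qed.

Lemma perm_insert2 (N : nat) (s : seq nat) (g : nat) :
  perm_eq (insert2 N s g) ([:: N; N] ++ s).
Proof. by rewrite perm_sym -{1}(cat_take_drop g s) perm_catCA. Qed.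

Lemma mem_stirling_perms (n : nat) (s : seq nat) :
  (s \in stirling_perms n) = stirling s && perm_eq s (double_iota n).
Proof. by rewrite mem_filter mem_permutations. Qed.

Lemma size_double_iota (n : nat) : size (double_iota n) = n.*2.
Proof. by elim: n => // n IHn; rewrite double_iotaS size_cat IHn /= addn2. Qed.

Lemma stirling_perms_bound (n : nat) (s : seq nat) :
  s \in stirling_perms n -> forall x, x \in s -> 0 < x <= n.
Proof.
rewrite mem_stirling_perms => /andP[_ /perm_mem s_n] x.
by rewrite s_n; apply: double_iota_bound.
Qed.

Lemma size_stirling_perms (n : nat) (s : seq nat) :
  s \in stirling_perms n -> size s = n.*2.
Proof.
rewrite mem_stirling_perms => /andP[_ /perm_size ->].
exact: size_double_iota.
Qed.

(** The two copies of [n.+1] are adjacent, since a letter between them would have to be larger;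
    deleting them inverts the insertion. *)
Lemma stirling_permsS (n : nat) :
  perm_eq (stirling_perms n.+1)
    [seq insert2 n.+1 s g | s <- stirling_perms n, g <- iota 0 n.*2.+1].
Proof.
have NN s : s \in stirling_perms n -> n.+1 \notin s.
  by move=> /stirling_perms_bound s_n; apply/negP => /s_n; rewrite ltnn andbF.
apply: uniq_perm; first by rewrite filter_uniq ?permutations_uniq.
  apply: allpairs_uniq; first by rewrite filter_uniq ?permutations_uniq.
    exact: iota_uniq.
  move=> ? ? /allpairsP[[s g] [s_n g_n ->]] /allpairsP[[t h] [t_n h_n ->]].
  move: s_n t_n => /= /[dup]s_n /NN Ns /[dup]t_n /NN Nt.
  (* Injectivity: filtering out [n.+1] recovers the permutation, and the first index of [n.+1]
     recovers the gap. *)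
  have rem_insert u k : n.+1 \notin u ->
      [seq z <- insert2 n.+1 u k | z != n.+1] = u.
    move=> Nu; rewrite filter_cat /= eqxx -filter_cat cat_take_drop.
    by apply/all_filterP/allP => z z_u; apply: contraNneq Nu => <-.
  have index_insert u k : n.+1 \notin u -> k <= size u ->
      index n.+1 (insert2 n.+1 u k) = k.
    move=> Nu k_u; rewrite index_cat /= eqxx addn0 size_takel //.
    by rewrite ifN //; apply: contra Nu; apply: mem_take.
  move=> e; have st : s = t by rewrite -(rem_insert s g) // e rem_insert.
  congr (_, _) => //.
  move: g_n h_n; rewrite !mem_iota /= -(size_stirling_perms s_n) ltnS => gs.
  by rewrite ltnS => hs; rewrite -(index_insert s g) // e index_insert -?st.
move=> s; rewrite mem_stirling_perms.
apply/andP/allpairsP => [[stir s_n]|[[t g] /= [t_n _ ->]]].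
  have Ns : n.+1 \in s.
    by rewrite (perm_mem s_n) double_iotaS mem_cat !inE eqxx !orbT.
  have N2 : count_mem n.+1 s = 2.
    have Nn : n.+1 \notin double_iota n.
      by apply/negP => /double_iota_bound; rewrite ltnn andbF.
    rewrite (permP s_n) double_iotaS count_cat /= eqxx.
    by rewrite (count_memPn Nn).
  have s_le x : x \in s -> x <= n.+1.
    by rewrite (perm_mem s_n) => /double_iota_bound /andP[].
  move: Ns s_n N2 s_le stir; rewrite -has_pred1.
  case/split_find => _ p q /eqP -> Np; rewrite cat_rcons => s_n N2 s_le.
  have Nq : n.+1 \in q.
    have p0 : count_mem n.+1 p = 0 by apply/count_memPn; rewrite -has_pred1.
    rewrite -has_pred1 has_count; move: N2.
    by rewrite count_cat p0 /= eqxx add0n add1n => -[->].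
  case/splitPr: Nq s_n s_le {N2} => r q' s_n s_le stir.
  case: r s_n s_le stir => [|z r] s_n s_le stir; last first.
    suff : n.+1 < z.
      by rewrite ltnNge s_le // mem_cat !inE eqxx !orbT.
    apply: (stirlingP _ stir); apply: subseq_trans (suffix_subseq _ _).
    by rewrite /= eqxx /= eqxx sub1seq mem_cat mem_head orbT.
  have insE : insert2 n.+1 (p ++ q') (size p) = p ++ [:: n.+1, n.+1 & q'].
    by rewrite /insert2 take_size_cat // drop_size_cat.
  have pq_n : perm_eq (p ++ q') (double_iota n).
    rewrite -(perm_cat2l [:: n.+1; n.+1]).
    rewrite -(permPl (perm_insert2 _ _ (size p))) insE (permPl s_n).
    by rewrite double_iotaS perm_catC.
  have lt_N : all (ltn^~ n.+1) (p ++ q').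
    by apply/allP => x; rewrite (perm_mem pq_n) => /double_iota_bound /andP[].
  exists (p ++ q', size p); split; rewrite ?mem_iota /=.
  - by rewrite mem_stirling_perms -(stirling_insert2 lt_N) stir.
  - rewrite add0n ltnS -(size_double_iota n) -(perm_size pq_n).
    by rewrite size_cat leq_addr.
  - by rewrite insE.
move: t_n; rewrite mem_stirling_perms => /andP[stir t_n]; split.
  rewrite stirling_insert2 cat_take_drop //.
  by apply/allP => x; rewrite (perm_mem t_n) => /double_iota_bound /andP[].
by rewrite (permPl (perm_insert2 _ _ _)) double_iotaS perm_catC perm_cat2r.
Qed.

(** * The statistics under insertion *)

Definition descent (e : nat -> nat) (k : nat) : bool := e k.+1 < e k.
Definition lplateau (e : nat -> nat) (k : nat) : bool :=
  (e k.-1 < e k) && (e k == e k.+1).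
(* The condition [0 < e k] discards the zeros that pad [entry s] beyond s. *)
Definition dplateau (e : nat -> nat) (k : nat) : bool :=
  [&& e k < e k.-1, e k == e k.+1 & 0 < e k].

Lemma entryS (s : seq nat) (k : nat) : entry s k.+1 = nth 0 s k.
Proof. exact: nth_rcons_default. Qed.

Lemma entry_oversize (s : seq nat) (k : nat) : size s < k -> entry s k = 0.
Proof. by case: k => // k s_k; rewrite entryS nth_default. Qed.

Lemma entry_gt0 (n : nat) (s : seq nat) (k : nat) : s \in stirling_perms n ->
  (0 < entry s k) = (0 < k <= size s).
Proof.
move=> s_n; case: k => [|k] //=; rewrite entryS.
have [k_s|k_s] := ltnP k (size s); last first.
  by rewrite nth_default.
by have /andP[] := stirling_perms_bound s_n (mem_nth 0 k_s).
Qed.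

Lemma entry_lt (n : nat) (s : seq nat) (k : nat) : s \in stirling_perms n ->
  entry s k < n.+1.
Proof.
move=> s_n; have [k_s|/entry_oversize ->//] := leqP k (size s).
case: k k_s => // k k_s; rewrite entryS ltnS.
by have /andP[] := stirling_perms_bound s_n (mem_nth 0 k_s).
Qed.

(** Positions count from the leading zero, so gap [g] lies between positions [g] and [g.+1], and the
    new pair occupies [g.+1] and [g.+2]. *)
Lemma entry_insert2 (N : nat) (s : seq nat) (g k : nat) : g <= size s ->
  entry (insert2 N s g) k =
  if k <= g then entry s k else if k <= g.+2 then N else entry s k.-2.
Proof.
move=> g_s; case: k => [|k] //; rewrite !entryS nth_cat size_takel //.
case: ltnP => [k_g|g_k]; first by rewrite nth_take.
case: (k - g) (subnKC g_k) => [|[|d]] <- /=.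
- by rewrite addn0 leqnSn.
- by rewrite addn1 leqnn.
- by rewrite !addnS entryS nth_drop !ltnS ltnNge leq_addr.
Qed.

(* Inserting two values after position g shifts all windows to the right of the
   gap by 2; only the windows meeting the gap change. *)
Lemma sum_window_insert (F F' : nat -> nat) (g M : nat) : g.+2 <= M ->
  (forall k, k < g -> F' k = F k) ->
  (forall k, g.+2 <= k -> F' k.+2 = F k) ->
  \sum_(0 <= k < M.+2) F' k + F g + F g.+1 =
  \sum_(0 <= k < M) F k + F' g + F' g.+1 + F' g.+2 + F' g.+3.
Proof.
move=> g_M F'lt F'ge.
have -> : \sum_(0 <= k < M) F k =
    \sum_(0 <= k < g) F k + F g + F g.+1 + \sum_(g.+2 <= k < M) F k.
  rewrite (big_cat_nat (n := g)) /=; [|lia..].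
  rewrite (big_ltn (m := g)); last lia.
  rewrite (big_ltn (m := g.+1)); last lia.
  by rewrite !addnA.
have -> : \sum_(0 <= k < M.+2) F' k = \sum_(0 <= k < g) F k +
    F' g + F' g.+1 + F' g.+2 + F' g.+3 + \sum_(g.+2 <= k < M) F k.
  rewrite (big_cat_nat (n := g)) /=; [|lia..].
  rewrite (eq_big_nat _ _ (F2 := F)); last by move=> k /andP[_]; apply: F'lt.
  rewrite (big_ltn (m := g)); last lia.
  rewrite (big_ltn (m := g.+1)); last lia.
  rewrite (big_ltn (m := g.+2)); last lia.
  rewrite (big_ltn (m := g.+3)); last lia.
  have -> : \sum_(g.+4 <= k < M.+2) F' k = \sum_(g.+2 <= k < M) F k.
    rewrite 2!big_add1 /=; apply: eq_big_nat => k /andP[g_k _]; exact: F'ge.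
  by rewrite !addnA.
lia.
Qed.

(** The freedom in [M] lets the counts for a word and for its extension take the form that
    [sum_window_insert] requires. *)
Lemma count_sum (P : pred nat) (m n M : nat) : n <= M ->
  (forall k, n <= k -> P k = false) ->
  count P (index_iota m n) = \sum_(m <= k < M) P k.
Proof.
move=> n_M P_n; have [n_m|m_n] := leqP n m.
  rewrite /index_iota (eqP n_m) big_nat big1 // => k /andP[m_k _].
  by rewrite P_n // (leq_trans n_m).
rewrite (big_cat_nat (n := n)) ?(ltnW m_n) //= [X in _ + X]big_nat.
rewrite [X in _ + X]big1 ?addn0; last by move=> k /andP[n_k _]; rewrite P_n.
by rewrite -sum1_count big_mkcond; apply: eq_bigr => k _; case: (P k).
Qed.

Lemma des_sum (s : seq nat) (M : nat) : size s < M ->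
  des s = \sum_(0 <= k < M) descent (entry s) k.
Proof.
move=> s_M; rewrite -(@count_sum _ _ (size s).+1) //.
by move=> k s_k; rewrite /descent (entry_oversize s_k).
Qed.

Lemma laplat_sum (s : seq nat) (M : nat) : size s < M ->
  laplat s = \sum_(0 <= k < M) lplateau (entry s) k.
Proof.
move=> s_M; rewrite big_ltn ?(leq_ltn_trans _ s_M) // add0n.
rewrite -(@count_sum _ _ (size s)) ?(ltnW s_M) //.
  by rewrite /index_iota subn1.
move=> k s_k; rewrite /lplateau [entry s k.+1]entry_oversize //.
by case: eqP => [->|]; rewrite ?andbF.
Qed.

Lemma desp_sum (n : nat) (s : seq nat) (M : nat) :
  s \in stirling_perms n -> size s < M ->
  desp s = \sum_(0 <= k < M) dplateau (entry s) k.
Proof.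
move=> s_n s_M; rewrite big_ltn ?(leq_ltn_trans _ s_M) // add0n.
rewrite -(@count_sum _ _ (size s)) ?(ltnW s_M) //.
  rewrite /index_iota subn1; apply: eq_in_count => k; rewrite mem_iota.
  move=> /andP[k_gt0 k_s]; rewrite /dplateau (entry_gt0 _ s_n) k_gt0.
  by rewrite (_ : k <= size s) ?andbT //; case: (size s) k_s => [|m] /=; lia.
move=> k s_k; rewrite /dplateau [entry s k.+1]entry_oversize //.
by case: eqP => [->|]; rewrite ?andbF.
Qed.

(** The middle one of three equal entries would have to exceed its neighbours; positivity excludes
    the padding zeros. *)
Lemma entry_no_triple (n : nat) (s : seq nat) (k : nat) :
  s \in stirling_perms n -> 0 < entry s k.+1 ->
  entry s k = entry s k.+1 -> entry s k.+1 = entry s k.+2 -> False.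
Proof.
move=> s_n pos e1 e2; have s_stir : stirling s.
  by move: s_n; rewrite mem_stirling_perms => /andP[].
case: k pos e1 e2 => [|k pos e1 e2]; first by move=> pos e1; rewrite -e1 in pos.
have k_s : k.+2 < size s.
  by have := pos; rewrite e2 (entry_gt0 _ s_n).
move: e1 e2; rewrite !entryS => e1 e2.
have k1_s := ltnW k_s; have k0_s := ltnW k1_s.
move/forallP/(_ (Ordinal k0_s)): s_stir.
move=> /forallP/(_ (Ordinal k1_s))/forallP/(_ (Ordinal k_s))/implyP /=.
by rewrite e1 e2 !ltnS !leqnn eqxx ltnn => /(_ isT).
Qed.

(** The new pair is a left ascent-plateau followed by a descent. It destroys a descent or plateau at
    the gap; a left ascent-plateau starting just after the gap is now preceded by [n.+1] and becomes
    a descent-plateau. The additive form avoids truncated subtraction. *)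
Lemma stat_insert2 (n g : nat) (s : seq nat) (e := entry s) :
  s \in stirling_perms n -> g <= n.*2 ->
  let s' := insert2 n.+1 s g in
  [/\ des s' + descent e g = des s + 1,
      laplat s' + lplateau e g + lplateau e g.+1 = laplat s + 1
    & desp s' + dplateau e g = desp s + lplateau e g.+1].
Proof.
move=> s_n g_n s'; have s_size := size_stirling_perms s_n.
have s'_n : s' \in stirling_perms n.+1.
  rewrite (perm_mem (stirling_permsS n)); apply/allpairsP.
  by exists (s, g); split; rewrite ?mem_iota.
have s'_size : size s' = n.*2.+2 by rewrite (size_stirling_perms s'_n) doubleS.
have g_s : g <= size s by rewrite s_size.
have eN k : e k < n.+1 by exact: entry_lt s_n.
have e'E k : entry s' k =
    if k <= g then e k else if k <= g.+2 then n.+1 else e k.-2.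
  exact: entry_insert2.
pose M := n.*2.+2; have g_M : g.+2 <= M by [].
have lt_M : size s < M by rewrite s_size.
have lt_M2 : size s' < M.+2 by rewrite s'_size.
have e'g : entry s' g = e g by rewrite e'E leqnn.
have e'g1 : entry s' g.+1 = n.+1 by rewrite e'E ltnn leqnSn.
have e'g2 : entry s' g.+2 = n.+1 by rewrite e'E leqnn; case: leqP => //; lia.
have e'lt k : k <= g -> entry s' k = e k by move=> k_g; rewrite e'E k_g.
have e'ge k : g.+1 <= k -> entry s' k.+2 = e k.
  by move=> g_k; rewrite e'E !ifN // -ltnNge // leqW // leqW.
have e'g3 : entry s' g.+3 = e g.+1 by rewrite e'ge.
have e'g4 : entry s' g.+4 = e g.+2 by rewrite e'ge.
split.
- rewrite (des_sum lt_M) (des_sum lt_M2).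
  have d0 : descent (entry s') g = false.
    by rewrite /descent e'g1 e'g leq_gtF // ltnW.
  have d1 : descent (entry s') g.+1 = false by rewrite /descent e'g2 e'g1 ltnn.
  have d2 : descent (entry s') g.+2 by rewrite /descent e'g3 e'g2 eN.
  have d3 : descent (entry s') g.+3 = descent e g.+1.
    by rewrite /descent e'g4 e'g3.
  have d_lt k : k < g -> descent (entry s') k = descent e k :> nat.
    by move=> k_g; rewrite /descent !e'lt // ltnW.
  have d_ge k : g.+2 <= k -> descent (entry s') k.+2 = descent e k :> nat.
    by move=> g_k; rewrite /descent !e'ge // ltnW // ltnW.
  have := sum_window_insert g_M d_lt d_ge; rewrite /= d0 d1 d2 d3 -/e; lia.
- rewrite (laplat_sum lt_M) (laplat_sum lt_M2).
  have l0 : lplateau (entry s') g = false.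
    by rewrite /lplateau e'g1 e'g (ltn_eqF (eN g)) andbF.
  have l1 : lplateau (entry s') g.+1 by rewrite /lplateau e'g2 e'g1 e'g eN eqxx.
  have l2 : lplateau (entry s') g.+2 = false.
    by rewrite /lplateau /= e'g1 e'g2 ltnn.
  have l3 : lplateau (entry s') g.+3 = false.
    by rewrite /lplateau /= e'g2 e'g3 leq_gtF // ltnW.
  have l_lt k : k < g -> lplateau (entry s') k = lplateau e k :> nat.
    by move=> k_g; rewrite /lplateau !e'lt // ?(ltnW k_g) // -ltnS ltnW //; lia.
  have l_ge k : g.+2 <= k -> lplateau (entry s') k.+2 = lplateau e k :> nat.
    by case: k => // k g_k; rewrite /lplateau /= !e'ge // ltnW // ltnW.
  have := sum_window_insert g_M l_lt l_ge; rewrite /= l0 l1 l2 l3 -/e; lia.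
rewrite (desp_sum s_n lt_M) (desp_sum s'_n lt_M2).
have p0 : dplateau (entry s') g = false.
  by rewrite /dplateau e'g1 e'g (ltn_eqF (eN g)) andbF.
have p1 : dplateau (entry s') g.+1 = false.
  by rewrite /dplateau /= e'g1 e'g leq_gtF // ltnW.
have p2 : dplateau (entry s') g.+2 = false.
  by rewrite /dplateau /= e'g1 e'g2 ltnn.
(* A positive plateau after the gap is now entered by a descent. Before, it was entered by an ascent
   or a descent, equality being excluded by [entry_no_triple]. *)
have p3 : dplateau (entry s') g.+3 = lplateau e g.+1 + dplateau e g.+1 :> nat.
  rewrite /dplateau /lplateau /= e'g2 e'g3 e'g4 eN /=.
  have [e12|] := eqVneq (e g.+1) (e g.+2); last by rewrite !andbF.
  rewrite andbT /=; case: (posnP (e g.+1)) => [->|pos].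
    by rewrite ltn0 andbF.
  have := @entry_no_triple n s g s_n pos; rewrite andbT -/e.
  by case: ltngtP => // e01 /(_ e01 e12).
have p_lt k : k < g -> dplateau (entry s') k = dplateau e k :> nat.
  by move=> k_g; rewrite /dplateau !e'lt // ?(ltnW k_g) //; lia.
have p_ge k : g.+2 <= k -> dplateau (entry s') k.+2 = dplateau e k :> nat.
  by case: k => // k g_k; rewrite /dplateau /= !e'ge // ltnW // ltnW.
have := sum_window_insert g_M p_lt p_ge; rewrite /= p0 p1 p2 p3 -/e; lia.
Qed.

(** * Recursion for the joint counts of the three statistics *)

Import GRing.Theory.
Local Open Scope ring_scope.

(** The terms correspond, in order, to descents, plateaus of left ascent-plateaus, plateaus of
    descent-plateaus, ascents into left ascent-plateaus, and all other gaps. *)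
Lemma sum_stat_insert2 (n : nat) (s : seq nat) (f : nat -> nat -> nat -> int) :
  s \in stirling_perms n ->
  \sum_(g <- iota 0 n.*2.+1) f (des (insert2 n.+1 s g))
    (laplat (insert2 n.+1 s g)) (desp (insert2 n.+1 s g)) =
  (des s)%:Z * f (des s) (laplat s).+1 (desp s)
  + (laplat s)%:Z * f (des s).+1 (laplat s) (desp s)
  + (desp s)%:Z * f (des s).+1 (laplat s).+1 (desp s).-1
  + (laplat s)%:Z * f (des s).+1 (laplat s) (desp s).+1
  + ((n.*2.+1)%:Z - (des s)%:Z - (laplat s)%:Z *+ 2 - (desp s)%:Z)
    * f (des s).+1 (laplat s).+1 (desp s).
Proof.
move=> s_n; set f1 := f (des s) _ _; set f2 := f _ (laplat s) (desp s).
set f3 := f _ _ (desp s).-1; set f4 := f _ _ (desp s).+1.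
set f5 := f _ _ (desp s).
have s_lt : (size s < n.*2.+1)%N by rewrite (size_stirling_perms s_n).
have gap g : g \in iota 0 n.*2.+1 ->
    f (des (insert2 n.+1 s g)) (laplat (insert2 n.+1 s g))
      (desp (insert2 n.+1 s g)) =
    (descent (entry s) g)%:Z * f1 + (lplateau (entry s) g)%:Z * f2
    + (dplateau (entry s) g)%:Z * f3 + (lplateau (entry s) g.+1)%:Z * f4
    + (1 - (descent (entry s) g)%:Z - (lplateau (entry s) g)%:Z
       - (dplateau (entry s) g)%:Z - (lplateau (entry s) g.+1)%:Z) * f5.
{ rewrite mem_iota ltnS => g_n.
  have [] := stat_insert2 s_n g_n.
  (* The classes are disjoint: comparing the entries at [g] and [g.+1] separates descent, plateau
     and ascent, and the entry before [g] separates the two kinds of plateau. *)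
  have : (descent (entry s) g + lplateau (entry s) g + dplateau (entry s) g
          + lplateau (entry s) g.+1 <= 1)%N.
    rewrite /descent /lplateau /dplateau /=.
    by case: ltngtP => _; case: ltngtP => _ //=; rewrite ?andbF; lia.
  move: (des _) (laplat _) (desp _) => d l p.
  case: descent; case: lplateau; case: dplateau;
    case: lplateau => //= _ dE lE pE.
  (* In each class the identities of [stat_insert2] determine the new values. *)
  all: try (have -> : d = des s by lia); try (have -> : d = (des s).+1 by lia).
  all: try (have -> : l = laplat s by lia);
       try (have -> : l = (laplat s).+1 by lia).
  all: try (have -> : p = desp s by lia);
       try (have -> : p = (desp s).+1 by lia);
       try (have -> : p = (desp s).-1 by lia).
  all: by rewrite ?mul0r ?subr0 ?mul1r ?addr0 ?add0r. }
have sumZ (b : nat -> nat) :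
    \sum_(g <- iota 0 n.*2.+1) (b g)%:Z = (\sum_(0 <= g < n.*2.+1) b g)%N%:Z.
  by rewrite (big_morph Posz PoszD (erefl _)) /index_iota subn0.
have desE := esym (des_sum s_lt).
have lapE := esym (laplat_sum s_lt).
(* The shift loses nothing: at position 0 the predecessor truncates to 0, so [lplateau] is false
   there. *)
have lapE' : (\sum_(0 <= g < n.*2.+1) lplateau (entry s) g.+1)%N = laplat s.
  rewrite (laplat_sum (M := n.*2.+2)); last by rewrite ltnW.
  by rewrite [RHS]big_ltn // big_add1.
have despE := esym (desp_sum s_n s_lt).
have sum1 : \sum_(g <- iota 0 n.*2.+1) (1 : int) = (n.*2.+1)%:Z.
  by rewrite big_const_seq count_predT size_iota iter_addr_0 natz.
rewrite (eq_big_seq _ gap) !big_split /= -!mulr_suml !sumrB sum1.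
rewrite !sumZ desE lapE lapE' despE; ring.
Qed.

Definition stat_is (i j k d l p : nat) : int := [&& d == i, l == j & p == k].

Definition stat_count (n i j k : nat) : int :=
  \sum_(s <- stirling_perms n) stat_is i j k (des s) (laplat s) (desp s).

(** Each term collects the permutations from which one class of gaps leads to the target triple. The
    two classes at left ascent-plateaus share the factor [j.+1]; the one raising [desp] contributes
    nothing when [k] is 0. *)
Lemma stat_countS (n i j k : nat) :
  stat_count n.+1 i.+1 j.+1 k =
  i.+1%:Z * stat_count n i.+1 j k
  + j.+1%:Z * (stat_count n i j.+1 k
               + (if k is k'.+1 then stat_count n i j.+1 k' else 0))
  + k.+1%:Z * stat_count n i j k.+1
  + (n.*2.+1%:Z - i%:Z - j%:Z *+ 2 - k%:Z) * stat_count n i j k.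
Proof.
rewrite /stat_count (perm_big _ (stirling_permsS n)) big_allpairs_dep /=.
transitivity (\sum_(s <- stirling_perms n)
  (i.+1%:Z * stat_is i.+1 j k (des s) (laplat s) (desp s)
  + j.+1%:Z * (stat_is i j.+1 k (des s) (laplat s) (desp s)
    + (if k is k'.+1 then stat_is i j.+1 k' (des s) (laplat s) (desp s) else 0))
  + k.+1%:Z * stat_is i j k.+1 (des s) (laplat s) (desp s)
  + (n.*2.+1%:Z - i%:Z - j%:Z *+ 2 - k%:Z)
    * stat_is i j k (des s) (laplat s) (desp s))).
  apply: eq_big_seq => s s_n.
  rewrite (sum_stat_insert2 (stat_is i.+1 j.+1 k) s_n) /stat_is.
  move: (des s) (laplat s) (desp s) => d l p.
  rewrite !eqSS mulrDr; congr (_ + _); last first.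
    by do 3!(case: eqP => [->|_]; rewrite ?mulr0 //=); rewrite mulr0.
  rewrite addrAC addrA; congr (_ + _); last first.
    (* For [p = 0] the factor [p] kills the term in which [p.-1] is truncated. *)
    case: p => [|p] /=; first by rewrite !andbF mul0r mulr0.
    by rewrite eqSS; have [->|_] := eqVneq p k; rewrite ?andbF ?mulr0.
  congr (_ + _ + _).
  - by have [->|_] := eqVneq d i.+1; rewrite ?mulr0.
  - by have [->|_] := eqVneq l j.+1; rewrite ?andbF ?mulr0.
  - case: k => [|k]; first by rewrite !andbF !mulr0.
    by rewrite eqSS; have [->|_] := eqVneq l j.+1; rewrite ?andbF ?mulr0.
rewrite !big_split /= -!mulr_sumr big_split /=; congr (_ + _ * (_ + _) + _ + _).
by case: k => // ; rewrite big1.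
Qed.

(** Only insertion at a descent keeps [des], and its term carries the factor [des s]. *)
Lemma stat_count0l (n j k : nat) : stat_count n.+1 0 j k = 0.
Proof.
rewrite /stat_count (perm_big _ (stirling_permsS n)) big_allpairs_dep /=.
rewrite big_seq big1 // => s s_n.
rewrite (sum_stat_insert2 (stat_is 0 j k) s_n) /stat_is /=.
rewrite !mulr0 !addr0.
by have [->|_] := eqVneq (des s) 0%N; rewrite ?mul0r ?mulr0.
Qed.

Lemma stat_count0r (n i k : nat) : stat_count n.+1 i 0 k = 0.
Proof.
rewrite /stat_count (perm_big _ (stirling_permsS n)) big_allpairs_dep /=.
rewrite big_seq big1 // => s s_n.
rewrite (sum_stat_insert2 (stat_is i 0 k) s_n) /stat_is /= !andbF.
by rewrite !mulr0 !addr0 add0r; have [->|_] := eqVneq (laplat s) 0%N;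
  rewrite ?andbF ?mul0r ?mulr0.
Qed.

(** * Coefficients of gamma *)

Lemma mcoeffMX_eq0 (n : nat) (R : comNzRingType) (p : {mpoly R[n]})
    (m k : 'X_{1..n}) : ~~ (m <= k)%MM -> (p * 'X_[m])@_k = 0.
Proof.
move=> m_k; apply/memN_msupp_eq0; rewrite (perm_mem (msuppMX _ _)).
by apply: contra m_k => /mapP[k' _ ->]; rewrite lem_addr.
Qed.

Lemma monXY_vx (i j : nat) : monXY i j vx = i.
Proof. by rewrite mnmDE !mulmnE !mnm1E mul1n mul0n addn0. Qed.

Lemma monXY_vy (i j : nat) : monXY i j vy = j.
Proof. by rewrite mnmDE !mulmnE !mnm1E mul1n mul0n add0n. Qed.

Lemma monXY_Sx (i j : nat) : monXY i.+1 j = (monXY i j + U_(vx))%MM.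
Proof. by apply/mnmP=> k; rewrite !(mnmDE, mulmnE); lia. Qed.

Lemma monXY_Sy (i j : nat) : monXY i j.+1 = (monXY i j + U_(vy))%MM.
Proof. by apply/mnmP=> k; rewrite !(mnmDE, mulmnE); lia. Qed.

Lemma mcoeffMx (p : {mpoly int[2]}) (i j : nat) :
  (p * X)@_(monXY i j) = if i is i'.+1 then p@_(monXY i' j) else 0.
Proof.
case: i => [|i]; last by rewrite monXY_Sx addmC mcoeffMX.
by rewrite mcoeffMX_eq0 // lep1mP monXY_vx.
Qed.

Lemma mcoeffMy (p : {mpoly int[2]}) (i j : nat) :
  (p * Y)@_(monXY i j) = if j is j'.+1 then p@_(monXY i j') else 0.
Proof.
case: j => [|j]; last by rewrite monXY_Sy addmC mcoeffMX.
by rewrite mcoeffMX_eq0 // lep1mP monXY_vy.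
Qed.

(** With all factors [X] and [Y] on the right, [mcoeffMx] and [mcoeffMy] apply directly. *)
Lemma gammaSE (n : nat) : (0 < n)%N ->
  gamma n.+1 = (gamma n *+ (4 * n + 2)
    + ((gamma n)^`M(vx) - ((gamma n)^`M(vx) * X) *+ 2)
    + ((gamma n)^`M(vy) - ((gamma n)^`M(vy) * Y) *+ 4)) * X * Y.
Proof.
move=> n_gt0; rewrite gammaS //; set m := (4 * n + 2)%N; ring.
Qed.

(** After removal of the factor $xy$, the operators $x\partial_x$ and $y\partial_y$ multiply by $i$
    and $j$, while the bare derivatives bring in the neighbouring coefficients. *)
Lemma gamma_coefS (n i j : nat) : (0 < n)%N ->
  (gamma n.+1)@_(monXY i.+1 j.+1) =
  ((4 * n + 2)%:Z - i%:Z *+ 2 - j%:Z *+ 4) * (gamma n)@_(monXY i j)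
  + i.+1%:Z * (gamma n)@_(monXY i.+1 j) + j.+1%:Z * (gamma n)@_(monXY i j.+1).
Proof.
move=> n_gt0; rewrite gammaSE // mcoeffMy mcoeffMx !mcoeffD !mcoeffN !mcoeffMn.
rewrite mcoeffMx mcoeffMy !mcoeff_deriv -monXY_Sx -monXY_Sy monXY_vx monXY_vy.
(* At [i = 0] the default value 0 agrees with the factor $i$. *)
have -> : match i with 0%N => 0 | i'.+1 => ((gamma n)^`M(vx))@_(monXY i' j) end
  = i%:Z * (gamma n)@_(monXY i j).
  case: i => [|i]; first by rewrite mul0r.
  by rewrite mcoeff_deriv -monXY_Sx monXY_vx -mulr_natl natz.
have -> : match j with 0%N => 0 | j'.+1 => ((gamma n)^`M(vy))@_(monXY i j') end
  = j%:Z * (gamma n)@_(monXY i j).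
  case: j => [|j]; first by rewrite mul0r.
  by rewrite mcoeff_deriv -monXY_Sy monXY_vy -mulr_natl natz.
rewrite -[_ *+ (4 * n + 2)]mulr_natl -[_ *+ i.+1]mulr_natl.
rewrite -[_ *+ j.+1]mulr_natl !natz; ring.
Qed.

Lemma gamma_coef0l (n j : nat) : (gamma n.+1)@_(monXY 0 j) = 0.
Proof.
case: n => [|n]; first by rewrite /= mulrC mcoeffMx.
by rewrite gammaSE // mulrAC mcoeffMx.
Qed.

Lemma gamma_coef0r (n i : nat) : (gamma n.+1)@_(monXY i 0) = 0.
Proof.
case: n => [|n]; first by rewrite /= mcoeffMy.
by rewrite gammaSE // mcoeffMy.
Qed.

Lemma gamma1_coef (i j : nat) :
  (gamma 1)@_(monXY i j) = ((i == 1%N) && (j == 1%N))%:R.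
Proof.
rewrite /= mcoeffMy; case: j => [|j]; first by rewrite andbF.
rewrite -[X]mul1r mcoeffMx; case: i => [|i] //.
rewrite mcoeff1 !eqSS; congr (nat_of_bool _)%:R.
apply/eqP/andP => [e|[/eqP -> /eqP ->]].
  have := monXY_vx i j; have := monXY_vy i j.
  by rewrite e !mnm0E => <- <-.
by rewrite /monXY !mulm0n addm0.
Qed.

(** * Closed form for the joint counts *)

Lemma stirling_perms0 : stirling_perms 0 = [:: [::]].
Proof.
by rewrite /stirling_perms /=; have -> : stirling [::] by apply/stirlingP.
Qed.

Lemma stat_count1 (i j k : nat) :
  stat_count 1 i j k = [&& i == 1%N, j == 1%N & k == 0%N]%:R.
Proof.
rewrite /stat_count (perm_big _ (stirling_permsS 0)) stirling_perms0 /=.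
by rewrite big_seq1 /stat_is natz /= ![_ == 1%N]eq_sym [k == _]eq_sym.
Qed.

(** This makes the truncated subtraction in the binomial of [stat_countE] harmless. *)
Lemma gamma_coef_eq0 (n i j : nat) : (0 < n)%N -> (n.*2.+1 < i + j.*2)%N ->
  (gamma n)@_(monXY i j) = 0.
Proof.
case: n => // n _; elim: n i j => [|n IHn] i j ij.
  by rewrite gamma1_coef; case: eqP ij => [->|] //; case: eqP => [->|].
case: i ij => [|i] ij; first exact: gamma_coef0l.
case: j ij => [|j] ij; first exact: gamma_coef0r.
rewrite gamma_coefS // (IHn i.+1 j) ?(IHn i j.+1); try lia.
rewrite !mulr0 !addr0; have [ij'|ij'] := ltnP n.+1.*2.+1 (i + j.*2).
  by rewrite IHn ?mulr0.
(* Here $i + 2j = 2n + 3$ exactly, beyond the reach of the induction hypothesis, but the factor of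
   the coefficient at $(i,j)$ is zero. *)
rewrite (_ : _ - _ - _ = 0) ?mul0r //; lia.
Qed.

(** By absorption both summands equal $m\binom{m-1}{k}$. This merges the two terms of [stat_countS]
    at $(i,j)$ into the single one of [gamma_coefS]. *)
Lemma mul_bin_succ_add (m k : nat) :
  k.+1%:Z * 'C(m, k.+1)%:Z + (m%:Z - k%:Z) * 'C(m, k)%:Z =
  m%:Z *+ 2 * 'C(m.-1, k)%:Z.
Proof.
have -> : (m%:Z - k%:Z) * 'C(m, k)%:Z = m%:Z * 'C(m.-1, k)%:Z.
  rewrite -PoszM mul_bin_down PoszM; have [k_m|m_k] := leqP k m.
    by rewrite subzn.
  by rewrite bin_small // !mulr0.
by rewrite -!PoszM mul_bin_left -mul_bin_down PoszM; ring.
Qed.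

(** In the induction the terms at $(i+1,j)$ agree at once, those at $(i,j+1)$ by Pascal's rule, and
    those at $(i,j)$ by [mul_bin_succ_add]. *)
Lemma stat_countE (n i j k : nat) : (0 < n)%N ->
  stat_count n i j k =
  (gamma n)@_(monXY i j) * ('C(n.*2.+1 - (i + j.*2), k))%:Z.
Proof.
case: n => // n _; elim: n i j k => [|n IHn] i j k.
  rewrite stat_count1 gamma1_coef -natz.
  case: eqP => [->|]; last by rewrite mul0r.
  case: eqP => [->|]; last by rewrite mul0r.
  by rewrite mul1r; case: k.
case: i => [|i]; first by rewrite stat_count0l gamma_coef0l mul0r.
case: j => [|j]; first by rewrite stat_count0r gamma_coef0r mul0r.
rewrite stat_countS gamma_coefS // !IHn.
have G0 := @gamma_coef_eq0 n.+1; move: G0.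
set G := fun i j => (gamma n.+1)@_(monXY i j) => G0.
rewrite -/(G i j) -/(G i.+1 j) -/(G i j.+1).
set M := (n.+2.*2.+1 - _)%N.
have -> : (n.+1.*2.+1 - (i.+1 + j.*2) = M)%N by rewrite /M; lia.
have -> : G i j.+1 * 'C(n.+1.*2.+1 - (i + j.+1.*2), k)
    + match k with 0%N => 0 | k'.+1 => stat_count n.+1 i j.+1 k' end
  = G i j.+1 * 'C(M, k).
  (* Pascal's rule needs [M] positive; when [M] is 0 the coefficient at $(i,j+1)$ vanishes. *)
  have [M0|M_gt0] := posnP M.
    have GE : G i j.+1 = 0 by apply: G0 => //; move: M0; rewrite /M; lia.
    by case: k => [|k]; rewrite ?IHn -/(G i j.+1) GE !mul0r ?addr0.
  have -> : (n.+1.*2.+1 - (i + j.+1.*2) = M.-1)%N by rewrite /M; lia.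
  case: k => [|k]; first by rewrite !bin0 addr0.
  rewrite IHn -/(G i j.+1) -mulrDr -PoszD.
  have -> : (n.+1.*2.+1 - (i + j.+1.*2) = M.-1)%N by rewrite /M; lia.
  by rewrite -binS prednK.
suff key : k.+1%:Z * (G i j * 'C(n.+1.*2.+1 - (i + j.*2), k.+1)%:Z)
    + (n.+1.*2.+1%:Z - i%:Z - j%:Z *+ 2 - k%:Z)
      * (G i j * 'C(n.+1.*2.+1 - (i + j.*2), k)%:Z)
  = ((4 * n.+1 + 2)%N%:Z - i%:Z *+ 2 - j%:Z *+ 4) * G i j * 'C(M, k)%:Z.
  by rewrite -addrA key; ring.
(* If the subtraction truncates, $G(i,j) = 0$; otherwise [m] is the true difference and both linear
   factors can be written in [m]. *)
have [ij|ij] := ltnP n.+1.*2.+1 (i + j.*2).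
  by rewrite [G i j]G0 // !(mul0r, mulr0) addr0.
set m := (n.+1.*2.+1 - _)%N; have -> : M = m.-1 by rewrite /M /m; lia.
rewrite (_ : _ - _ - _ - _ = m%:Z - k%:Z); last by rewrite /m; lia.
rewrite (_ : _ - _ - _ = m%:Z *+ 2); last by rewrite /m; lia.
rewrite mulrCA [X in _ + X]mulrCA -mulrDr mul_bin_succ_add; ring.
Qed.

Theorem theorem10 (n i j : nat) (hn : (1 <= n)%N) :
  (gamma n)@_(monXY i j) =
  (count (fun s => [&& des s == i, laplat s == j & desp s == 0%N])
         (stirling_perms n))%:Z.
Proof.
have := stat_countE i j 0 hn; rewrite bin0 mulr1 => <-.
rewrite -sum1_count (big_morph Posz PoszD (erefl _)) [RHS]big_mkcond /=.
by apply: eq_bigr => s _; rewrite /stat_is; case: andP.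
Qed.
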